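(* Let $p$ be a prime number with $p\equiv 3\pmod 8$ and $R=\mathbb Z_2[X]/(X^2+p)$. Let $M_1$ and $M_2$ be two self-dual skew-Hermitian modules over $R$. Suppose there is an isomorphism $$M_1\oplus L_0^{\oplus s}\simeq M_2\oplus L_0^{\oplus s}$$ of skew-Hermitian modules for some integer $s\ge 0$. Then $M_1$ is isometric to $M_2$ (that is, isomorphic as a skew-Hermitian module).
   Context: Write $R=\mathbb Z_2[\pi]$ with $\pi$ the image of $X$, $\omega=\pi-1$, $E=R\otimes_{\mathbb Z_2}\mathbb Q_2$ (an unramified quadratic field extension of $\mathbb Q_2$), $O_E=\mathbb Z_2[\omega/2]$ its ring of integers, and $a\mapsto\bar a$ the non-trivial automorphism of $E$ over $\mathbb Q_2$. A skew-Hermitian module over $R$ is a finitely generated $R$-module $M$ that is free over $\mathbb Z_2$, together with a non-degenerate alternating $\mathbb Z_2$-bilinear pairing $\psi:M\times M\to\mathbb Z_2$ such that $\psi(ax,y)=\psi(x,\bar a y)$ for all $a\in R$, $x,y\in M$. It is self-dual if $\psi$ induces an isomorphism $M\to \mathrm{Hom}_{\mathbb Z_2}(M,\mathbb Z_2)$. Isomorphisms are $R$-linear isomorphisms preserving the pairings, and $\oplus$ denotes orthogonal direct sum. $L_0=(L_0,\psi_0)$ is the self-dual skew-Hermitian module with underlying $R$-module $O_E$ and alternating pairing determined by $\psi_0(1,\omega/2)=1$. *)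

(* Defs.v *)
From HB Require Import structures.
From mathcomp Require Import all_boot all_algebra.
From mathcomp Require Import boolp.
From mathcomp Require Import ring zify.

Set Implicit Arguments.
Unset Strict Implicit.
Unset Printing Implicit Defensive.

Import GRing.Theory.
Local Open Scope ring_scope.

(* The ring of 2-adic integers, as the inverse limit of the rings Z/2^(n+1); the
   shift avoids 'Z_1, which denotes Z/2. *)

Definition Zred n (x : 'Z_(2 ^ n.+2)) : 'Z_(2 ^ n.+1) := (x : nat)%:R.

Lemma exp2_gt1 n : (1 < 2 ^ n.+1)%N.
Proof. by rewrite -{1}(expn0 2) ltn_exp2l. Qed.

Lemma Zred_nat n (m : nat) : Zred (m%:R : 'Z_(2 ^ n.+2)) = m%:R.
Proof.
apply: val_inj; rewrite /Zred /= !val_Zp_nat ?exp2_gt1 //.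
by rewrite modn_dvdm // dvdn_exp2l.
Qed.

Lemma ZredE n (x : 'Z_(2 ^ n.+2)) : x = (x : nat)%:R.
Proof. by rewrite natr_Zp. Qed.

Lemma ZredD n : {morph @Zred n : x y / x + y}.
Proof. by move=> x y; rewrite (ZredE x) (ZredE y) -natrD !Zred_nat natrD. Qed.

Lemma ZredM n : {morph @Zred n : x y / x * y}.
Proof. by move=> x y; rewrite (ZredE x) (ZredE y) -natrM !Zred_nat natrM. Qed.

Lemma Zred0 n : @Zred n 0 = 0. Proof. exact: (@Zred_nat n 0). Qed.

Lemma Zred1 n : @Zred n 1 = 1. Proof. exact: (@Zred_nat n 1). Qed.

Lemma ZredN n : {morph @Zred n : x / - x}.
Proof. by move=> x; apply/eqP; rewrite -addr_eq0 -ZredD addNr Zred0. Qed.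

Record Z2 : Type := MkZ2 {
  zdig :> forall n, 'Z_(2 ^ n.+1);
  zdigP : forall n, Zred (zdig n.+1) = zdig n }.

Lemma Z2_ext (x y : Z2) : (forall n, x n = y n) -> x = y.
Proof.
case: x y => [x xP] [y yP] /= xy.
have {}xy : x = y by apply: functional_extensionality_dep.
by subst y; congr MkZ2; apply: Prop_irrelevance.
Qed.

HB.instance Definition _ := gen_eqMixin Z2.
HB.instance Definition _ := gen_choiceMixin Z2.

Definition Z2_zero : Z2 := MkZ2 Zred0.
Definition Z2_one : Z2 := MkZ2 Zred1.
Fact Z2_opp_subproof (x : Z2) n : Zred (- x n.+1) = - x n.
Proof. by rewrite ZredN zdigP. Qed.
Definition Z2_opp (x : Z2) : Z2 := MkZ2 (Z2_opp_subproof x).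
Fact Z2_add_subproof (x y : Z2) n : Zred (x n.+1 + y n.+1) = x n + y n.
Proof. by rewrite ZredD !zdigP. Qed.
Definition Z2_add (x y : Z2) : Z2 := MkZ2 (Z2_add_subproof x y).
Fact Z2_mul_subproof (x y : Z2) n : Zred (x n.+1 * y n.+1) = x n * y n.
Proof. by rewrite ZredM !zdigP. Qed.
Definition Z2_mul (x y : Z2) : Z2 := MkZ2 (Z2_mul_subproof x y).

Fact Z2_addA : associative Z2_add.
Proof. by move=> x y z; apply: Z2_ext => n /=; rewrite addrA. Qed.
Fact Z2_addC : commutative Z2_add.
Proof. by move=> x y; apply: Z2_ext => n /=; rewrite addrC. Qed.
Fact Z2_add0 : left_id Z2_zero Z2_add.
Proof. by move=> x; apply: Z2_ext => n /=; rewrite add0r. Qed.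
Fact Z2_addN : left_inverse Z2_zero Z2_opp Z2_add.
Proof. by move=> x; apply: Z2_ext => n /=; rewrite addNr. Qed.
HB.instance Definition _ :=
  GRing.isZmodule.Build Z2 Z2_addA Z2_addC Z2_add0 Z2_addN.

Fact Z2_mulA : associative Z2_mul.
Proof. by move=> x y z; apply: Z2_ext => n /=; rewrite mulrA. Qed.
Fact Z2_mulC : commutative Z2_mul.
Proof. by move=> x y; apply: Z2_ext => n /=; rewrite mulrC. Qed.
Fact Z2_mul1 : left_id Z2_one Z2_mul.
Proof. by move=> x; apply: Z2_ext => n /=; rewrite mul1r. Qed.
Fact Z2_mulD : left_distributive Z2_mul +%R.
Proof. by move=> x y z; apply: Z2_ext => n /=; rewrite mulrDl. Qed.
Fact Z2_one_neq0 : Z2_one != 0.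
Proof. by apply/eqP => /(congr1 (fun x : Z2 => x 0%N)). Qed.
HB.instance Definition _ :=
  GRing.Zmodule_isComNzRing.Build Z2 Z2_mulA Z2_mulC Z2_mul1 Z2_mulD
    Z2_one_neq0.

Definition Z2_unit : {pred Z2} := fun x => `[< exists y, y * x = 1 >].
Definition Z2_inv (x : Z2) : Z2 :=
  if pselect (exists y, y * x = 1) is left e then projT1 (cid e) else x.
Fact Z2_mulV : {in Z2_unit, left_inverse 1 Z2_inv *%R}.
Proof.
move=> x /asboolP xU; rewrite /Z2_inv; case: pselect => // e.
by case: (cid e).
Qed.
Fact Z2_unitP (x y : Z2) : y * x = 1 -> Z2_unit x.
Proof. by move=> yx; apply/asboolP; exists y. Qed.
Fact Z2_inv_out : {in [predC Z2_unit], Z2_inv =1 id}.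
Proof.
move=> x; rewrite !inE => /asboolP xU.
by rewrite /Z2_inv; case: pselect.
Qed.
HB.instance Definition _ :=
  GRing.ComNzRing_hasMulInverse.Build Z2 Z2_mulV Z2_unitP Z2_inv_out.

Lemma zdig_le (x : Z2) n k : (x (n + k)%N)%:R = x n :> 'Z_(2 ^ n.+1).
Proof.
elim: k => [|k IH]; first by rewrite addn0 natr_Zp.
rewrite -IH addnS -(zdigP x (n + k)) /Zred.
apply: val_inj; rewrite /= !val_Zp_nat ?exp2_gt1 // modn_dvdm //.
by rewrite dvdn_exp2l // ltnS leq_addr.
Qed.

Lemma zdig_eq0 (x : Z2) n k : (x n == 0) = (2 ^ n.+1 %| x (n + k)%N)%N.
Proof.
rewrite -(zdig_le x n k) -val_eqE /= val_Zp_nat ?exp2_gt1 //.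
Qed.

Fact Z2_idomain : GRing.integral_domain_axiom Z2.
Proof.
move=> x y xy; apply/norP => -[x0 y0].
have nz (z : Z2) : z != 0 -> exists n, z n != 0.
  move=> z0; apply: contrapT => h; case/eqP: z0; apply: Z2_ext => n.
  by case: (eqVneq (z n) 0) => // zn; case: h; exists n.
have [n xn] := nz _ x0; have [m ym] := nz _ y0.
set k := (n + m).+1.
have xk : ~~ (2 ^ n.+1 %| x k)%N by rewrite /k -addnS -zdig_eq0.
have yk : ~~ (2 ^ m.+1 %| y k)%N.
  by rewrite /k addnC -addSn addSnnS -zdig_eq0.
have xpos : (0 < x k)%N by rewrite lt0n; apply: contraNneq xk => ->; rewrite dvdn0.
have ypos : (0 < y k)%N by rewrite lt0n; apply: contraNneq yk => ->; rewrite dvdn0.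
have : (2 ^ k.+1 %| x k * y k)%N.
  have /(congr1 (fun z : Z2 => val (z k))) /= := xy.
  by rewrite [in X in (_ %% X)%N]Zp_cast ?exp2_gt1 // => /eqP.
rewrite pfactor_dvdn ?muln_gt0 ?xpos // lognM //.
rewrite !pfactor_dvdn // -!ltnNge !ltnS in xk yk.
by apply/negP; rewrite -ltnNge /k ltnS (leq_trans (leq_add xk yk)).
Qed.
HB.instance Definition _ := GRing.ComUnitRing_isIntegral.Build Z2 Z2_idomain.

Notation Q2 := {fraction Z2}.
Notation "x %:F" := (@FracField.tofrac Z2 x) : ring_scope.

Definition quadp (A : comNzRingType) (p : nat) : {poly A} := 'X^2 + p%:R%:P.

Section Quadratic.
Variables (A : comNzRingType) (p : nat).
Local Notation Q := {poly %/ quadp A p}.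
Implicit Types (x y : Q) (f : {poly A}).

Lemma size_quadp : size (quadp A p) = 3.
Proof. by rewrite /quadp size_XnaddC. Qed.

Lemma monic_quadp : quadp A p \is monic.
Proof. by rewrite /quadp monicXnaddC. Qed.

(* The quotient {poly %/ h} is by [mk_monic h], which is [h] only if [h] is
   monic of positive degree. *)
Lemma mk_monic_quadp : mk_monic (quadp A p) = quadp A p.
Proof. by rewrite /mk_monic size_quadp monic_quadp. Qed.

(* For A = Q_2 (resp. Z_2), the automorphism pi |-> - pi of E (resp. R). *)
Definition qconj x : Q := in_qpoly (quadp A p) ((x : {poly A}) \Po (- 'X)).

Lemma quad_split x : x = (x`_0)%:P + x`_1 *: 'X :> {poly A}.
Proof.
have sx : (size x <= 2)%N.
  by rewrite -ltnS (leq_trans (size_mk_monic x)) // mk_monic_quadp size_quadp.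
apply/polyP => -[|[|i]]; rewrite coefD coefC coefZ coefX ?mulr0 ?mulr1 ?addr0 ?add0r //=.
by rewrite nth_default // (leq_trans sx).
Qed.

Lemma quad_ext x y : x`_0 = y`_0 -> x`_1 = y`_1 -> x = y.
Proof. by move=> e0 e1; apply: val_inj => /=; rewrite quad_split e0 e1 -quad_split. Qed.

Lemma in_quad_small f : (size f <= 2)%N -> in_qpoly (quadp A p) f = f :> {poly A}.
Proof. by move=> sf; rewrite in_qpoly_small // mk_monic_quadp size_quadp. Qed.

Lemma size_lin (a b : A) : (size (a%:P + b *: 'X)%R <= 2)%N.
Proof.
rewrite (leq_trans (size_polyD _ _)) // geq_max (leq_trans (size_polyC_leq1 _)) //=.
by rewrite (leq_trans (size_scale_leq _ _)) // size_polyX.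
Qed.

Lemma quadX_sqr : in_qpoly (quadp A p) 'X^2 = (- p%:R)%:A.
Proof.
have -> : 'X^2 = quadp A p - p%:R%:P by rewrite /quadp addrK.
have h0 : in_qpoly (quadp A p) (quadp A p) = 0.
  by apply: val_inj; rewrite /= mk_monic_quadp Pdiv.RingMonic.rmodpp ?monic_quadp.
rewrite rmorphB /= h0 sub0r scaleNr; congr (- _).
by rewrite -[p%:R%:P]alg_polyC linearZ /= rmorph1.
Qed.

Lemma quad_ctx (a b : A) :
  ((in_qpoly (quadp A p) (a%:P + b *: 'X))`_0 = a)
  * ((in_qpoly (quadp A p) (a%:P + b *: 'X))`_1 = b).
Proof.
rewrite !in_quad_small ?size_lin //.
by split; rewrite coefD coefC coefZ coefX /= ?mulr0 ?mulr1 ?addr0 ?add0r.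
Qed.

Lemma quad_inK x : in_qpoly (quadp A p) x = x.
Proof.
by apply: val_inj; apply: in_quad_small; rewrite quad_split size_lin.
Qed.

Lemma quad_mulE x y :
  x * y = in_qpoly (quadp A p)
    ((x`_0 * y`_0 - p%:R * (x`_1 * y`_1))%:P + (x`_0 * y`_1 + x`_1 * y`_0) *: 'X).
Proof.
rewrite -[LHS]/(in_qpoly _ ((x : {poly A}) * y)) [in LHS](quad_split x).
rewrite [in LHS](quad_split y).
have -> : ((x`_0)%:P + x`_1 *: 'X) * ((y`_0)%:P + y`_1 *: 'X) =
   (x`_0 * y`_0)%:P + (x`_0 * y`_1 + x`_1 * y`_0) *: 'X + (x`_1 * y`_1) *: 'X^2
   :> {poly A}.
  by rewrite -!mul_polyC !polyCM polyCD !polyCM; ring.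
rewrite linearD /= linearZ /= quadX_sqr polyCB addrAC [RHS]raddfB; congr (_ + _).
rewrite scalerA mulrN scaleNr; congr (- _).
rewrite [x`_1 * y`_1 * _]mulrC -[in RHS]alg_polyC.
by rewrite [RHS]linearZ /= rmorph1.
Qed.

Lemma quad_coef0M x y : (x * y)`_0 = x`_0 * y`_0 - p%:R * (x`_1 * y`_1).
Proof. by rewrite quad_mulE quad_ctx. Qed.

Lemma quad_coef1M x y : (x * y)`_1 = x`_0 * y`_1 + x`_1 * y`_0.
Proof. by rewrite quad_mulE quad_ctx. Qed.

Lemma qconjE x : ((qconj x)`_0 = x`_0) * ((qconj x)`_1 = - x`_1).
Proof.
have -> : qconj x = in_qpoly _ ((x`_0)%:P + (- x`_1) *: 'X).
  rewrite /qconj [in LHS](quad_split x) comp_polyD comp_polyC comp_polyZ.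
  by rewrite comp_polyX scaleNr scalerN.
exact: quad_ctx.
Qed.

Lemma quadCE (a : A) : (((a%:A : Q)`_0 = a) * ((a%:A : Q)`_1 = 0)).
Proof. by rewrite /= !coefZ !coefC /= mulr1 mulr0. Qed.

Lemma quadXE : ((('qX : Q)`_0 = 0) * (('qX : Q)`_1 = 1)).
Proof. by rewrite /qpolyX !in_quad_small ?size_polyX // !coefX. Qed.

Lemma quad_coefD x y i : (x + y)`_i = x`_i + y`_i.
Proof. exact: coefD. Qed.

Lemma quad_coefN x i : (- x)`_i = - x`_i.
Proof. exact: coefN. Qed.

Lemma quad_coefZ (a : A) x i : (a *: x)`_i = a * x`_i.
Proof. exact: coefZ. Qed.

Lemma quad_coef1 : ((1 : Q)`_0 = 1) * ((1 : Q)`_1 = 0).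
Proof. by rewrite /= !coefC. Qed.

End Quadratic.

Notation Rring p := {poly %/ quadp Z2 p}.
Notation Efield p := {poly %/ quadp Q2 p}.

Definition R_to_E p (r : Rring p) : Efield p :=
  in_qpoly (quadp Q2 p) (map_poly (@FracField.tofrac Z2) r).

Lemma R_to_E_coef p (r : Rring p) :
  (((R_to_E r)`_0 = (r`_0)%:F) * ((R_to_E r)`_1 = (r`_1)%:F)).
Proof.
have -> : R_to_E r = in_qpoly _ (((r`_0)%:F)%:P + (r`_1)%:F *: 'X).
  by rewrite /R_to_E [in LHS](quad_split r) rmorphD /= map_polyC map_polyZ map_polyX.
exact: quad_ctx.
Qed.

Lemma R_to_E_is_zmod_morphism p : zmod_morphism (@R_to_E p).
Proof. by move=> x y; rewrite /R_to_E !raddfB. Qed.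

Lemma R_to_E_is_monoid_morphism p : monoid_morphism (@R_to_E p).
Proof.
split; first by rewrite /R_to_E /= rmorph1 rmorph1.
move=> x y; apply: quad_ext.
  by rewrite !(quad_coef0M, R_to_E_coef) rmorphB !rmorphM /= rmorph_nat.
by rewrite !(quad_coef1M, R_to_E_coef) rmorphD !rmorphM.
Qed.

HB.instance Definition _ p :=
  GRing.isZmodMorphism.Build _ _ (@R_to_E p) (@R_to_E_is_zmod_morphism p).
HB.instance Definition _ p :=
  GRing.isMonoidMorphism.Build _ _ (@R_to_E p) (@R_to_E_is_monoid_morphism p).

Lemma tofrac_inj : injective (@FracField.tofrac Z2).
Proof. by move=> x y /eqP; rewrite tofrac_eq => /eqP. Qed.

Lemma R_to_E_inj p : injective (@R_to_E p).
Proof.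
move=> x y exy; apply: quad_ext; apply: tofrac_inj.
  by rewrite -!R_to_E_coef exy.
by rewrite -!R_to_E_coef exy.
Qed.

Lemma R_to_E_conj p (r : Rring p) : R_to_E (qconj r) = qconj (R_to_E r).
Proof. by apply: quad_ext; rewrite !(R_to_E_coef, qconjE) ?rmorphN. Qed.

Definition Z2_to_E p : Z2 -> Efield p :=
  qpolyC (quadp Q2 p) \o @FracField.tofrac Z2.

HB.instance Definition _ p := GRing.RMorphism.on (@Z2_to_E p).

Definition omega p : Efield p := 'qX - 1.
Definition half_omega p : Efield p := 2%:R^-1 *: omega p.

(* O_E = Z_2[omega/2], as a subring of E. *)
Definition OE_pred p : {pred Efield p} :=
  fun x => `[< exists f : {poly Z2}, x = (map_poly (@Z2_to_E p) f).[half_omega p] >].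

Lemma OE_predP p (x : Efield p) :
  reflect (exists f : {poly Z2}, x = (map_poly (@Z2_to_E p) f).[half_omega p])
    (x \in @OE_pred p).
Proof. exact: asboolP. Qed.

Fact OE_subring p : subring_closed (@OE_pred p).
Proof.
split.
- by apply/OE_predP; exists 1; rewrite rmorph1 hornerC.
- move=> _ _ /OE_predP[f ->] /OE_predP[g ->]; apply/OE_predP.
  by exists (f - g); rewrite rmorphB /= hornerD hornerN.
- move=> _ _ /OE_predP[f ->] /OE_predP[g ->]; apply/OE_predP.
  by exists (f * g); rewrite rmorphM /= hornerM.
Qed.
HB.instance Definition _ p :=
  GRing.isSubringClosed.Build (Efield p) (@OE_pred p) (@OE_subring p).

Record OE (p : nat) : Type := MkOE { OEval :> Efield p; OEvalP : OEval \in @OE_pred p }.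
HB.instance Definition _ p := [isSub for @OEval p].
HB.instance Definition _ p := [Choice of OE p by <:].
HB.instance Definition _ p := [SubChoice_isSubComNzRing of OE p by <:].

Lemma two_neq0 : 2%:R != 0 :> Z2.
Proof. by apply/eqP => /(congr1 (fun x : Z2 => x 1%N)). Qed.

Lemma twoF_neq0 : 2%:R != 0 :> Q2.
Proof. by rewrite -(rmorph_nat (@FracField.tofrac Z2)) tofrac_eq0 two_neq0. Qed.

Lemma half_omega_coef p :
  ((half_omega p)`_0 = - 2%:R^-1) * ((half_omega p)`_1 = 2%:R^-1).
Proof.
rewrite /half_omega /omega !quad_coefZ !quad_coefD !quad_coefN !quadXE !quad_coef1.
by rewrite sub0r mulrN mulr1 subr0 mulr1.
Qed.

Lemma Z2_to_E_coef p c : (((Z2_to_E p c)`_0 = c%:F) * ((Z2_to_E p c)`_1 = 0)).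
Proof. by rewrite /= !coefC. Qed.

Lemma Z2_to_E_OE p c : Z2_to_E p c \in @OE_pred p.
Proof. by apply/OE_predP; exists c%:P; rewrite map_polyC hornerC. Qed.

Lemma half_omega_OE p : half_omega p \in @OE_pred p.
Proof. by apply/OE_predP; exists 'X; rewrite map_polyX hornerX. Qed.

Lemma OE_lin_coef p (a b : Z2) :
  ((Z2_to_E p a + Z2_to_E p b * half_omega p)`_0 = a%:F - b%:F / 2%:R)
  * ((Z2_to_E p a + Z2_to_E p b * half_omega p)`_1 = b%:F / 2%:R).
Proof.
have [a0 a1] := Z2_to_E_coef p a; have [b0 b1] := Z2_to_E_coef p b.
have [h0 h1] := half_omega_coef p.
move: (Z2_to_E p a) (Z2_to_E p b) (half_omega p) a0 a1 b0 b1 h0 h1 => x y h.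
move=> a0 a1 b0 b1 h0 h1.
rewrite !quad_coefD quad_coef0M quad_coef1M a0 a1 b0 b1 h0 h1.
by rewrite !mul0r mulr0 subr0 addr0 add0r mulrN.
Qed.

Lemma R_to_E_OE p (r : Rring p) : R_to_E r \in @OE_pred p.
Proof.
suff -> : R_to_E r = Z2_to_E p (r`_0 + r`_1) + Z2_to_E p (2%:R * r`_1) * half_omega p.
  by rewrite rpredD ?rpredM ?Z2_to_E_OE ?half_omega_OE.
apply: quad_ext; rewrite R_to_E_coef OE_lin_coef;
  rewrite [X in X / _]rmorphM /= (rmorph_nat (@FracField.tofrac Z2)) mulrAC divff ?twoF_neq0 //.
  by rewrite mul1r rmorphD /= addrK.
by rewrite mul1r.
Qed.

Section OEmodule.
Variable p : nat.

Fact OE_scale_subproof (r : Rring p) (x : OE p) : R_to_E r * OEval x \in @OE_pred p.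
Proof. by apply: rpredM; [exact: R_to_E_OE | exact: OEvalP]. Qed.

Definition OE_scale (r : Rring p) (x : OE p) : OE p :=
  MkOE (OE_scale_subproof r x).

Fact OE_scaleA a b x : OE_scale a (OE_scale b x) = OE_scale (a * b) x.
Proof. by apply: val_inj; rewrite /= rmorphM /= mulrA. Qed.
Fact OE_scale1 : left_id 1 OE_scale.
Proof. by move=> x; apply: val_inj; rewrite /= rmorph1 mul1r. Qed.
Fact OE_scaleDr : right_distributive OE_scale +%R.
Proof. by move=> a x y; apply: val_inj; rewrite /= mulrDr. Qed.
Fact OE_scaleDl x : {morph OE_scale^~ x : a b / a + b}.
Proof. by move=> a b; apply: val_inj; rewrite /= rmorphD /= mulrDl. Qed.

HB.instance Definition _ := GRing.Zmodule_isLmodule.Build (Rring p) (OE p)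
  OE_scaleA OE_scale1 OE_scaleDr OE_scaleDl.

Definition OE_half_omega : OE p := MkOE (half_omega_OE p).

End OEmodule.

Section SkewHermitian.
Variable p : nat.
Implicit Types M N : lmodType (Rring p).

(* The Z_2-module structure of an R-module. *)
Definition zscale M (c : Z2) (x : M) : M := (c%:A : Rring p) *: x.

Definition Z2_linear M (f : M -> Z2) : Prop :=
  forall (c : Z2) (x y : M), f (zscale c x + y) = c * f x + f y.

Definition finitely_generated M : Prop :=
  exists (I : finType) (e : I -> M),
    forall x : M, exists c : I -> Rring p, x = \sum_i c i *: e i.

(* Free of finite rank: R is finite over Z_2, so a finitely generated R-module
   that is free over Z_2 has finite rank. *)
Definition Z2_free M : Prop :=
  exists (I : finType) (e : I -> M),
    (forall x : M, exists c : I -> Z2, x = \sum_i zscale (c i) (e i)) /\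
    (forall c : I -> Z2, \sum_i zscale (c i) (e i) = 0 -> forall i, c i = 0).

Record skew_hermitian M (psi : M -> M -> Z2) : Prop := {
  sh_fg : finitely_generated M;
  sh_free : Z2_free M;
  sh_linl : forall y, Z2_linear (psi^~ y);
  sh_linr : forall x, Z2_linear (psi x);
  sh_alt : forall x, psi x x = 0;
  sh_nondeg : forall x, (forall y, psi x y = 0) -> x = 0;
  sh_adj : forall (a : Rring p) (x y : M), psi (a *: x) y = psi x (qconj a *: y) }.

End SkewHermitian.

Record skewHermitianModule (p : nat) := SkewHermitianModule {
  shm_sort :> lmodType (Rring p);
  shm_form : shm_sort -> shm_sort -> Z2;
  shm_axioms : skew_hermitian shm_form }.

Definition self_dual p (M : skewHermitianModule p) : Prop :=
  forall f : M -> Z2, Z2_linear f -> exists! x : M, shm_form x = f.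

Definition isometric p (M N : skewHermitianModule p) : Prop :=
  exists f : {linear M -> N}, bijective f /\
    forall x y, shm_form (f x) (f y) = shm_form x y.

Section Sums.
Variable p : nat.

Lemma zscaleE (M : lmodType (Rring p)) c (x : M) : zscale c x = (c%:A : Rring p) *: x.
Proof. by []. Qed.

Lemma zscale0 (M : lmodType (Rring p)) (x : M) : zscale 0 x = 0.
Proof. by rewrite /zscale !scale0r. Qed.

Lemma Z2_linear0 (M : lmodType (Rring p)) (f : M -> Z2) : Z2_linear f -> f 0 = 0.
Proof.
move=> lf; have := lf 1 0 0; rewrite /zscale scaler0 addr0 mul1r => e.
by apply: (addrI (f 0)); rewrite addr0 -e.
Qed.

Variables M N : skewHermitianModule p.

(* Orthogonal direct sums M (+) N and M^(+)s. *)
Definition osum_form (u v : M * N) : Z2 :=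
  shm_form u.1 v.1 + shm_form u.2 v.2.

Lemma sumr_pair (I : finType) (F : I -> M * N) :
  \sum_i F i = (\sum_i (F i).1, \sum_i (F i).2).
Proof. by rewrite [LHS]surjective_pairing !raddf_sum. Qed.

Lemma zscale_sumr_pair (I : finType) (F : I -> M * N) (c : I -> Z2) :
  \sum_i zscale (c i) (F i) =
  (\sum_i zscale (c i) (F i).1, \sum_i zscale (c i) (F i).2).
Proof. exact: sumr_pair. Qed.

Fact osum_skew_hermitian : skew_hermitian osum_form.
Proof.
have [[I [e Ie]] [I' [e' [e'S e'F]]] ll lr al nd ad] := shm_axioms M.
have [[J [h Jh]] [J' [h' [h'S h'F]]] ll' lr' al' nd' ad'] := shm_axioms N.
split.
- exists (I + J)%type.
  exists (fun k => match k with inl i => (e i, 0) | inr j => (0, h j) end).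
  move=> [x y]; have [c ->] := Ie x; have [d ->] := Jh y.
  exists (fun k => match k with inl i => c i | inr j => d j end).
  rewrite sumr_pair !big_sumType /=.
  rewrite [X in (_ + X, _)]big1 => [|j _]; last by rewrite scaler0.
  by rewrite [X in (_, X + _)]big1 ?addr0 ?add0r // => i _; rewrite scaler0.
- exists (I' + J')%type.
  pose b := fun k : I' + J' => match k with
    inl i => (e' i, 0) | inr j => (0, h' j) end : M * N.
  have bE (c : I' + J' -> Z2) : \sum_k zscale (c k) (b k) =
      (\sum_i zscale (c (inl i)) (e' i), \sum_j zscale (c (inr j)) (h' j)).
    rewrite zscale_sumr_pair !big_sumType /=.
    rewrite [X in (_ + X, _)]big1 => [|j _]; last by rewrite /zscale scaler0.
    by rewrite [X in (_, X + _)]big1 ?addr0 ?add0r // => i _; rewrite /zscale scaler0.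
  exists b; split=> [[x y]|c].
    have [c ->] := e'S x; have [d ->] := h'S y.
    by exists (fun k => match k with inl i => c i | inr j => d j end); rewrite bE.
  rewrite bE => -[/e'F c1 /h'F c2] [i|j]; [exact: c1 | exact: c2].
- move=> y c u v; rewrite /osum_form /=.
  by rewrite (ll y.1) (ll' y.2) mulrDr addrACA.
- move=> y c u v; rewrite /osum_form /=.
  by rewrite (lr y.1) (lr' y.2) mulrDr addrACA.
- by move=> x; rewrite /osum_form al al' addr0.
- move=> [x y] xy0; congr pair.
    apply: nd => z; have := xy0 (z, 0); rewrite /osum_form /=.
    by rewrite (Z2_linear0 (lr' y)) addr0.
  apply: nd' => z; have := xy0 (0, z); rewrite /osum_form /=.
  by rewrite (Z2_linear0 (lr x)) add0r.
- by move=> a x y; rewrite /osum_form /= ad ad'.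
Qed.

Definition osum : skewHermitianModule p := SkewHermitianModule osum_skew_hermitian.

Variable s : nat.

Definition opow_form (u v : {ffun 'I_s -> M}) : Z2 :=
  \sum_i shm_form (u i) (v i).

Definition ffun_single (i : 'I_s) (x : M) : {ffun 'I_s -> M} :=
  [ffun j => if j == i then x else 0].

Fact opow_skew_hermitian : skew_hermitian opow_form.
Proof.
have [[I [e Ie]] [I' [e' [e'S e'F]]] ll lr al nd ad] := shm_axioms M.
have sumE (K : finType) (b : K -> M) (T : pzRingType) (a : T -> M -> M)
    (a0 : forall t, a t 0 = 0) (c : 'I_s * K -> T) i :
  \sum_k a (c k) (ffun_single k.1 (b k.2) i) = \sum_k a (c (i, k)) (b k).
  rewrite (eq_bigr (fun k => a (c (k.1, k.2)) (ffun_single k.1 (b k.2) i))); last by case.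
  rewrite -(pair_bigA _ (fun j k => a (c (j, k)) (ffun_single j (b k) i))) /=.
  rewrite (bigD1 i) //= [X in _ + X]big1 ?addr0 => [|j ji].
    by apply: eq_bigr => k _; rewrite ffunE eqxx.
  by apply: big1 => k _; rewrite ffunE eq_sym (negPf ji) a0.
split.
- exists ('I_s * I)%type, (fun k => ffun_single k.1 (e k.2)) => x.
  have [c cE] := choice (fun i => Ie (x i)).
  exists (fun k => c k.1 k.2); apply/ffunP => i.
  rewrite sum_ffunE cE -(sumE _ _ _ _ (@scaler0 _ _) (fun k => c k.1 k.2)).
  by apply: eq_bigr => k _; rewrite !ffunE.
- have zE (c : 'I_s * I' -> Z2) i :
    (\sum_k zscale (c k) (ffun_single k.1 (e' k.2))) i =
    \sum_k zscale (c (i, k)) (e' k).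
    rewrite sum_ffunE -(sumE _ _ _ (@zscale p M)) => [|t]; last exact: scaler0.
    by apply: eq_bigr => k _; rewrite !ffunE.
  exists ('I_s * I')%type, (fun k => ffun_single k.1 (e' k.2)); split=> [x|c c0].
    have [c cE] := choice (fun i => e'S (x i)).
    by exists (fun k => c k.1 k.2); apply/ffunP => i; rewrite zE cE.
  by move=> [i k]; apply: (e'F (fun k => c (i, k))); rewrite -zE c0 ffunE.
- move=> y c u v; rewrite /opow_form mulr_sumr -big_split /=.
  by apply: eq_bigr => i _; rewrite !ffunE (ll (y i)).
- move=> y c u v; rewrite /opow_form mulr_sumr -big_split /=.
  by apply: eq_bigr => i _; rewrite !ffunE (lr (y i)).
- by move=> x; rewrite /opow_form big1 // => i _; rewrite al.
- move=> x x0; apply/ffunP => i; rewrite ffunE; apply: nd => y.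
  rewrite -(x0 (ffun_single i y)) /opow_form (bigD1 i) //= ffunE eqxx.
  rewrite big1 ?addr0 // => j ji.
  by rewrite ffunE (negPf ji) (Z2_linear0 (lr (x j))).
- by move=> a x y; apply: eq_bigr => i _; rewrite !ffunE ad.
Qed.

Definition opow : skewHermitianModule p := SkewHermitianModule opow_skew_hermitian.

End Sums.

Definition Q2_to_Z2 (q : Q2) : Z2 :=
  if pselect (exists z : Z2, q = z%:F) is left e then projT1 (cid e) else 0.

Lemma tofracK : cancel (@FracField.tofrac Z2) Q2_to_Z2.
Proof.
move=> z; rewrite /Q2_to_Z2; case: pselect => [e|[]]; last by exists z.
by case: (cid e) => /= x /tofrac_inj.
Qed.

(* Since pi = 1 + 2 (omega/2), for x = x_0 + x_1 pi = a + b (omega/2) and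
   y = y_0 + y_1 pi = c + d (omega/2) one has a d - b c = 2 (x_0 y_1 - x_1 y_0),
   which is in Z_2 if x and y are in O_E = Z_2 + Z_2 (omega/2). *)
Definition L0_form p (x y : OE p) : Z2 :=
  Q2_to_Z2 (2%:R * ((OEval x)`_0 * (OEval y)`_1 - (OEval x)`_1 * (OEval y)`_0)).

Section L0.
Variable p : nat.
Variable hp : p = 3 %[mod 8].

Let k := (p.+1 %/ 4)%N.

Lemma succp_4k : p.+1 = (4 * k)%N.
Proof. by rewrite /k; lia. Qed.

Lemma half_omega_sqr :
  half_omega p * half_omega p = - half_omega p - Z2_to_E p k%:R.
Proof.
have [h0 h1] := half_omega_coef p; have [k0 k1] := Z2_to_E_coef p k%:R.
move: (half_omega p) (Z2_to_E p _) h0 h1 k0 k1 => h c h0 h1 c0 c1.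
have pk : p%:R = 4%:R * k%:R - 1 :> Q2 by rewrite -natrM -succp_4k -natr1 addrK.
have t0 := twoF_neq0.
apply: quad_ext; rewrite ?quad_coef0M ?quad_coef1M !quad_coefD !quad_coefN.
  by rewrite h0 h1 c0 pk rmorph_nat; field.
by rewrite h0 h1 c1; field.
Qed.

Lemma OE_span (x : OE p) :
  exists ab : Z2 * Z2,
    OEval x = Z2_to_E p ab.1 + Z2_to_E p ab.2 * half_omega p.
Proof.
case: x => x /= /OE_predP[f ->]; elim/poly_ind: f => [|f c [[a b] /= IH]].
  by exists (0, 0); rewrite /= !rmorph0 hornerC mul0r addr0.
exists (c - b * k%:R, a - b) => /=.
rewrite rmorphD rmorphM /= map_polyX map_polyC hornerD hornerM hornerX hornerC IH.
rewrite mulrDl -mulrA half_omega_sqr !rmorphB rmorphM /=.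
move: (Z2_to_E p a) (Z2_to_E p b) (Z2_to_E p c) (Z2_to_E p k%:R) (half_omega p).
by move=> ? ? ? ? ?; ring.
Qed.

Definition OE_of (a b : Z2) : OE p :=
  zscale a (1 : OE p) + zscale b (OE_half_omega p).

Lemma R_to_E_alg (c : Z2) : R_to_E (c%:A : Rring p) = Z2_to_E p c.
Proof.
have [c0 c1] := quadCE p c; have [d0 d1] := Z2_to_E_coef p c.
have [e0 e1] := R_to_E_coef (c%:A : Rring p).
by apply: quad_ext; rewrite (e0, e1) (c0, c1) (d0, d1) ?rmorph0.
Qed.

Lemma OE_zscale (c : Z2) (x : OE p) : OEval (zscale c x) = Z2_to_E p c * OEval x.
Proof. by rewrite -R_to_E_alg. Qed.

Lemma OE_ofE a b : OEval (OE_of a b) = Z2_to_E p a + Z2_to_E p b * half_omega p.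
Proof.
transitivity (OEval (zscale a (1 : OE p)) + OEval (zscale b (OE_half_omega p))) => //.
by rewrite !OE_zscale -[OEval 1]/(1 : Efield p) mulr1.
Qed.

Lemma OE_ofP x : exists a b, x = OE_of a b.
Proof.
by have [[a b] /= e] := OE_span x; exists a, b; apply: val_inj; rewrite [RHS]OE_ofE.
Qed.

Lemma OE_of_coef a b :
  ((OEval (OE_of a b))`_0 = a%:F - b%:F / 2%:R) * ((OEval (OE_of a b))`_1 = b%:F / 2%:R).
Proof. by have [e0 e1] := OE_lin_coef p a b; rewrite OE_ofE. Qed.

Lemma L0_formE a b c d : L0_form (OE_of a b) (OE_of c d) = a * d - b * c.
Proof.
rewrite /L0_form; have [x0 x1] := OE_of_coef a b; have [y0 y1] := OE_of_coef c d.
rewrite x0 x1 y0 y1 -[RHS]tofracK rmorphB !rmorphM /=; congr Q2_to_Z2.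
by have t0 := twoF_neq0; field.
Qed.

Lemma OE_of_inj a b c d : OE_of a b = OE_of c d -> a = c /\ b = d.
Proof.
move=> e; have := L0_formE 0 1 a b; have := L0_formE 1 0 a b.
rewrite e !L0_formE !mul1r !mul0r !subr0 !sub0r => -> /oppr_inj ->.
by [].
Qed.

Lemma OE_of_lin r a b c d :
  zscale r (OE_of a b) + OE_of c d = OE_of (r * a + c) (r * b + d).
Proof.
apply: val_inj; rewrite [RHS]OE_ofE.
transitivity (OEval (zscale r (OE_of a b)) + OEval (OE_of c d)) => //.
rewrite OE_zscale !OE_ofE !rmorphD !rmorphM /=.
by move: (Z2_to_E p a) (Z2_to_E p b) (Z2_to_E p c) (Z2_to_E p d) (Z2_to_E p r)
  (half_omega p) => *; ring.
Qed.

Lemma L0_formF (x y : OE p) : (L0_form x y)%:F =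
  2%:R * ((OEval x)`_0 * (OEval y)`_1 - (OEval x)`_1 * (OEval y)`_0).
Proof.
have [a [b ->]] := OE_ofP x; have [c [d ->]] := OE_ofP y.
have [x0 x1] := OE_of_coef a b; have [y0 y1] := OE_of_coef c d.
rewrite L0_formE x0 x1 y0 y1 rmorphB !rmorphM /=.
by have t0 := twoF_neq0; field.
Qed.

Fact L0_skew_hermitian : skew_hermitian (@L0_form p).
Proof.
have bE (c : bool -> Z2) :
    \sum_i zscale (c i) (if i then 1 : OE p else OE_half_omega p)
    = OE_of (c true) (c false) by rewrite big_bool.
split.
- exists bool, (fun i => if i then 1 : OE p else OE_half_omega p) => x.
  have [a [b ->]] := OE_ofP x.
  by exists (fun i => if i then a%:A else b%:A); rewrite big_bool.
- exists bool, (fun i => if i then 1 : OE p else OE_half_omega p); split=> [x|c].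
    by have [a [b ->]] := OE_ofP x; exists (fun i => if i then a else b); rewrite bE.
  rewrite bE; have -> : 0 = OE_of 0 0 by rewrite /OE_of !zscale0 addr0.
  by move=> /OE_of_inj[c1 c2] [].
- move=> y r u v; have [a [b ->]] := OE_ofP u; have [c [d ->]] := OE_ofP v.
  by have [a' [b' ->]] := OE_ofP y; rewrite OE_of_lin !L0_formE; ring.
- move=> y r u v; have [a [b ->]] := OE_ofP u; have [c [d ->]] := OE_ofP v.
  by have [a' [b' ->]] := OE_ofP y; rewrite OE_of_lin !L0_formE; ring.
- by move=> x; have [a [b ->]] := OE_ofP x; rewrite L0_formE mulrC subrr.
- move=> x; have [a [b ->]] := OE_ofP x => x0.
  have := x0 (OE_of 0 1); rewrite L0_formE mulr1 mulr0 subr0 => ->.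
  have := x0 (OE_of 1 0); rewrite L0_formE mulr1 mulr0 sub0r => /eqP.
  by rewrite oppr_eq0 => /eqP ->; rewrite /OE_of !zscale0 addr0.
- move=> r x y; apply: tofrac_inj; rewrite !L0_formF.
  rewrite -[OEval (r *: x)]/(R_to_E r * OEval x).
  rewrite -[OEval (qconj r *: y)]/(R_to_E (qconj r) * OEval y) R_to_E_conj.
  move: (R_to_E r) (OEval x) (OEval y) => {}r u v.
  have [r0 r1] := qconjE r; move: (qconj r) r0 r1 => r' r0 r1.
  by rewrite !quad_coef0M !quad_coef1M r0 r1; ring.
Qed.

Definition L0 : skewHermitianModule p := SkewHermitianModule L0_skew_hermitian.

Lemma L0_form_determined (psi : OE p -> OE p -> Z2) :
  (forall y, Z2_linear (psi^~ y)) -> (forall x, Z2_linear (psi x)) ->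
  (forall x, psi x x = 0) -> psi 1 (OE_half_omega p) = 1 ->
  psi = @L0_form p.
Proof.
move=> ll lr al e1.
have skew x y : psi y x = - psi x y.
  have := al (x + y); rewrite -[x in x + y](scale1r x).
  have E : (1 : Rring p) *: x = zscale 1 x by rewrite /zscale !scale1r.
  rewrite E (ll (zscale 1 x + y) 1 x y) !(lr _ 1 x y) !mul1r !al add0r addr0 => /eqP.
  by rewrite addrC addr_eq0 => /eqP.
have lin0 (f : OE p -> Z2) : Z2_linear f -> forall c x, f (zscale c x) = c * f x.
  by move=> lf c x; have := lf c x 0; rewrite (Z2_linear0 lf) !addr0.
apply/funext => x; apply/funext => y.
have [a [b ->]] := OE_ofP x; have [c [d ->]] := OE_ofP y.
rewrite L0_formE {1}/OE_of (ll _ a 1 _) (lin0 (psi^~ _) (ll _)).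
rewrite {1 2}/OE_of !(lr _ c 1 _) !(lin0 _ (lr _)) !al e1 skew e1.
by ring.
Qed.

Lemma L0_form1 : L0_form 1 (OE_half_omega p) = 1.
Proof.
have -> : (1 : OE p) = OE_of 1 0 by rewrite /OE_of zscale0 addr0 /zscale !scale1r.
have -> : OE_half_omega p = OE_of 0 1 by rewrite /OE_of zscale0 add0r /zscale !scale1r.
by rewrite L0_formE mulr1 mul0r subr0.
Qed.

Lemma L0_self_dual : self_dual L0.
Proof.
move=> f lf; have lin0 c x : f (zscale c x) = c * f x.
  by have := lf c x 0; rewrite (Z2_linear0 lf) !addr0.
exists (OE_of (f (OE_half_omega p)) (- f 1)); split.
  apply/funext => y; have [c [d ->]] := OE_ofP y.
  by rewrite /= L0_formE /OE_of lf lin0; ring.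
move=> x; have [a [b ->]] := OE_ofP x => /= <-.
have -> : OE_half_omega p = OE_of 0 1 by rewrite /OE_of zscale0 add0r /zscale !scale1r.
have -> : (1 : OE p) = OE_of 1 0 by rewrite /OE_of zscale0 addr0 /zscale !scale1r.
by rewrite !L0_formE !mulr1 !mulr0 subr0 sub0r opprK.
Qed.

End L0.

(* Main.v *)
Require Import Defs.
From HB Require Import structures.
From mathcomp Require Import all_boot all_algebra.
From mathcomp Require Import boolp ring zify.

Set Implicit Arguments.
Unset Strict Implicit.
Unset Printing Implicit Defensive.

(** The modules [L0] are cancelled one at a time, so the claim is that an
isometry [f : M + L0 -> N + L0] forces [M] and [N] to be isometric.

Write [f] as a two by two matrix and let [d : L0 -> L0] be its lower right corner.
If [1 - d] is invertible, the output of [f] in [L0] can be fed back as an input: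
for each [a] there is exactly one [l] such that the [L0]-component of [f (a, l)]
is [l] again, and then [f (a, l) = (b, l)] defines a linear map [a |-> b].  It is
isometric because the terms of [l] on both sides of the equality of forms are the
same.  It is onto if [1 - d'] is onto, with [d'] the corner of the inverse of [f];
this is [feedback_isometric].

It remains to make [1 - d] invertible.  An [R]-linear endomorphism of [L0] is
multiplication by some [t] in [O_E] ([OE_endo]), and [d'] is the adjoint of [d], so
that invertibility of [1 - t] gives that of [1 - d'] ([cancel_L0_unit]).  With
[h = omega / 2] and [4 k = p + 1] one has [h^2 + h + k = 0].  As [p = 3 mod 8],
[k] is odd, hence the residue ring of [O_E] modulo 2 is the field with four
elements, and an element of [O_E] is a unit as soon as it is nonzero modulo 2
([OE_of_unit]).  If [1 - t] is not a unit, then [t = 1 mod 2], and [1 - c t] is a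
unit for any unit [c] that is not 1 modulo 2.  Choosing such a [c] of norm 1,
multiplication by [c] is an isometry of [L0], and composing [f] with it on the
summand [L0] of the target replaces [t] by [c t] ([L0_twist_unit]). *)

Import GRing.Theory.

(** * Isometries, and feedback through a common summand *)

Section Isometries.
Local Open Scope ring_scope.
Variable p : nat.
Implicit Types M N P L : skewHermitianModule p.

Lemma isometric_sym M N : isometric M N -> isometric N M.
Proof.
move=> [f [[g fK gK] fE]].
pose gL : {linear N -> M} := HB.pack g
  (GRing.isLinear.Build _ _ _ _ g (can2_linear fK gK)).
exists gL; split; first by exists f.
by move=> x y; rewrite -fE !gK.
Qed.

Lemma isometric_trans N M P : isometric M N -> isometric N P -> isometric M P.
Proof.
move=> [f [bf fE]] [g [bg gE]].
exists (g \o f : {linear M -> P}); split; first exact: bij_comp.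
by move=> x y; rewrite /= gE fE.
Qed.

Lemma isometric_osum0 M L : isometric (osum M (opow L 0)) M.
Proof.
have lin : linear (fun u : M * {ffun 'I_0 -> L} => u.1) by [].
pose f : {linear osum M (opow L 0) -> M} :=
  HB.pack (fun u : osum M (opow L 0) => u.1) (GRing.isLinear.Build _ _ _ _ _ lin).
exists f; split.
  exists (fun x => (x, 0)) => // -[x u]; congr pair.
  by apply/ffunP => -[].
by move=> x y; rewrite /= /osum_form /= /opow_form big_ord0 addr0.
Qed.

Lemma isometric_osumS M L s :
  isometric (osum M (opow L s.+1)) (osum (osum M (opow L s)) L).
Proof.
pose F (u : osum M (opow L s.+1)) : osum (osum M (opow L s)) L :=
  ((u.1, [ffun i => u.2 (lift ord0 i)]), u.2 ord0).
pose G (w : osum (osum M (opow L s)) L) : osum M (opow L s.+1) :=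
  (w.1.1, [ffun i => if unlift ord0 i is Some j then w.1.2 j else w.2]).
have lin : linear F.
  move=> a [x u] [y v]; rewrite /F /= !ffunE; congr ((_, _), _).
  by apply/ffunP => i; rewrite !ffunE.
pose f : {linear osum M (opow L s.+1) -> osum (osum M (opow L s)) L} :=
  HB.pack F (GRing.isLinear.Build _ _ _ _ _ lin).
exists f; split.
  exists G.
    move=> [x u]; congr pair; apply/ffunP => i; rewrite ffunE /=.
    by case: unliftP => [j|] -> //=; rewrite ffunE.
  move=> [[x u] l]; rewrite /= /F /=; congr ((_, _), _).
    by apply/ffunP => i; rewrite !ffunE liftK.
  by rewrite ffunE unlift_none.
move=> [x u] [y v]; rewrite /= /osum_form /= /osum_form /opow_form big_ord_recl -addrA.
congr (_ + _); rewrite addrC; congr (_ + _).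
by apply: eq_bigr => i _; rewrite !ffunE.
Qed.

Lemma shm_form0l M (y : M) : shm_form 0 y = 0.
Proof. exact: Z2_linear0 (sh_linl (shm_axioms M) y). Qed.

Lemma shm_form0r M (x : M) : shm_form x 0 = 0.
Proof. exact: Z2_linear0 (sh_linr (shm_axioms M) x). Qed.

Lemma shm_formD M (x y z : M) : shm_form x (y + z) = shm_form x y + shm_form x z.
Proof.
by have := sh_linr (shm_axioms M) x 1 y z; rewrite /zscale !scale1r mul1r.
Qed.

Lemma shm_formDl M (x y z : M) : shm_form (x + y) z = shm_form x z + shm_form y z.
Proof.
by have := sh_linl (shm_axioms M) z 1 x y; rewrite /zscale !scale1r mul1r.
Qed.

Lemma shm_formC M (x y : M) : shm_form x y = - shm_form y x.
Proof.
have alt := sh_alt (shm_axioms M); apply/eqP; rewrite -addr_eq0.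
by have := alt (x + y); rewrite shm_formD !shm_formDl !alt add0r addr0 addrC => ->.
Qed.

Lemma shm_form_sep M (x y : M) :
  (forall z, shm_form z x = shm_form z y) -> x = y.
Proof.
move=> xy; apply/subr0_eq; apply: (sh_nondeg (shm_axioms M)) => z.
apply: (addIr (shm_form y z)); rewrite -shm_formDl subrK add0r.
by rewrite shm_formC xy -shm_formC.
Qed.

(** Feeding the [L]-component of the output back into the input: [w], the inverse
of the identity minus the corner of [f], solves [l = (f (a, l)).2] for [l].
The hypothesis on the corner of the inverse [g] makes the resulting map onto. *)
Lemma feedback_isometric M N L (f : {linear osum M L -> osum N L})
    (g : osum N L -> osum M L) :
  cancel f g -> cancel g f ->
  (forall x y, shm_form (f x) (f y) = shm_form x y) ->
  (exists w : {linear L -> L}, forall y,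
     w y - (f (0, w y)).2 = y /\ w (y - (f (0, y)).2) = y) ->
  (forall y, exists l, l - (g (0, l)).2 = y) ->
  isometric M N.
Proof.
move=> fK gK fE [w wK] surj'.
have fD a l : f (a, l) = f (a, 0) + f (0, l).
  rewrite -raddfD; congr (f _); apply/pair_equal_spec; split => /=.
    by rewrite addr0.
  by rewrite add0r.
pose l0 (a : M) : L := w (f (a, 0)).2.
pose F (a : M) : N := (f (a, l0 a)).1.
have fF a : f (a, l0 a) = (F a, l0 a).
  rewrite [LHS]surjective_pairing; congr pair.
  rewrite fD /=; have [/eqP e _] := wK (f (a, 0)).2.
  rewrite subr_eq in e; exact/esym/eqP.
have l0_lin : linear l0.
  move=> r a b; rewrite /l0.
  have -> : (r *: a + b, 0) = r *: (a, 0) + (b, 0) :> osum M L.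
    by congr pair; rewrite /= scaler0 addr0.
  by rewrite linearP /= linearP.
have F_lin : linear F.
  move=> r a b; rewrite /F l0_lin.
  have -> : (r *: a + b, r *: l0 a + l0 b) = r *: (a, l0 a) + (b, l0 b) :> osum M L by [].
  by rewrite linearP.
have FE a b : shm_form (F a) (F b) = shm_form a b.
  have := fE (a, l0 a) (b, l0 b); rewrite !fF /= /osum_form /=; exact: addIr.
(* Solving instead for the [l] that is fixed by feedback through [g] yields a
   preimage of [b], by uniqueness of the solution for [f]. *)
have Fsurj b : exists a, F a = b.
  have [l le] := surj' (g (b, 0)).2.
  have glin : linear g := can2_linear fK gK.
  have gD : g (b, l) = g (b, 0) + g (0, l).
    have -> : (b, l) = 1 *: (b, 0) + (0, l) :> osum N L.
      by rewrite scale1r; congr pair; rewrite /= ?addr0 ?add0r.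
    by rewrite glin scale1r.
  have gl : g (b, l) = ((g (b, l)).1, l).
    rewrite [LHS]surjective_pairing; congr pair.
    by rewrite gD /= -le subrK.
  have fl : f ((g (b, l)).1, l) = (b, l) by rewrite -gl gK.
  exists (g (b, l)).1; rewrite /F.
  suff -> : l0 (g (b, l)).1 = l by rewrite fl.
  rewrite /l0 -[RHS](wK l).2; congr (w _); apply/eqP.
  have /= e := congr1 snd fl; rewrite fD /= in e.
  by rewrite eq_sym subr_eq e.
have [G GK] := boolp.choice Fsurj.
(* An isometric map with nondegenerate source is injective. *)
have Finj : injective F.
  move=> a b ab; apply: shm_form_sep => c.
  by rewrite -FE ab FE.
pose FL : {linear M -> N} := HB.pack F (GRing.isLinear.Build _ _ _ _ F F_lin).
exists FL; split=> //; exists G => [a|]; last exact: GK.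
by apply: Finj; rewrite GK.
Qed.

End Isometries.

(** * Units of the 2-adic integers *)

Section Z2Units.
Local Open Scope ring_scope.

Lemma zdig_unit (x : Z2) n : x 0%N != 0 -> x n \is a GRing.unit.
Proof.
rewrite (zdig_eq0 x 0 n) add0n expn1 dvdn2 negbK => xo.
rewrite -[x n]natr_Zp unitZpE ?exp2_gt1 //.
by rewrite coprimeXl // coprime2n.
Qed.

(** The inverses modulo the powers of 2 exist as soon as the last digit is odd, and
they are compatible by uniqueness of inverses. *)
Lemma odd_Z2_unit (x : Z2) : x 0%N != 0 -> x \is a GRing.unit.
Proof.
move=> x0.
have inv n : Zred (x n.+1)^-1 = (x n)^-1.
  apply: (mulrI (zdig_unit n x0)); rewrite mulrV ?zdig_unit //.
  by rewrite -[in LHS](zdigP x n) -ZredM mulrV ?zdig_unit // Zred1.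
apply/unitrP; exists (MkZ2 inv).
by split; apply: Z2_ext => n /=; rewrite ?mulVr ?mulrV ?zdig_unit.
Qed.

End Z2Units.

(** * Arithmetic of the maximal order *)

Section MaximalOrder.
Local Open Scope ring_scope.
Variables (p : nat) (hp : p = 3 %[mod 8]).

(** The constant term of the equation [h^2 + h + quarter = 0] of [h = omega / 2]. *)
Definition quarter : Z2 := (p.+1 %/ 4)%:R.

(** This is where [p] is required to be 3 modulo 8 rather than modulo 4: the
polynomial [h^2 + h + quarter] is then irreducible modulo 2. *)
Lemma quarter_odd : quarter 0%N != 0.
Proof.
have -> : quarter 0%N = (p.+1 %/ 4)%:R :> 'Z_(2 ^ 1).
  rewrite /quarter; elim: (p.+1 %/ 4)%N => // n IH.
  by rewrite -!natr1 -IH.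
rewrite -val_eqE /= val_Zp_nat //.
lia.
Qed.

Lemma OE_ofM a b c d :
  OE_of p a b * OE_of p c d =
  OE_of p (a * c - quarter * (b * d)) (a * d + b * c - b * d).
Proof.
apply: val_inj; transitivity (OEval (OE_of p a b) * OEval (OE_of p c d)) => //.
rewrite [RHS]OE_ofE !OE_ofE.
rewrite !(rmorphB, rmorphD, rmorphM) /=.
have := half_omega_sqr hp; rewrite -/quarter.
move: (Z2_to_E p a) (Z2_to_E p b) (Z2_to_E p c) (Z2_to_E p d) (Z2_to_E p quarter)
  (half_omega p) => A B C D K H HH.
transitivity (A * C + (A * D + B * C) * H + B * D * (H * H)); first by ring.
by rewrite HH; ring.
Qed.

Lemma OE_ofB a b c d : OE_of p a b - OE_of p c d = OE_of p (a - c) (b - d).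
Proof.
have := OE_of_lin p (-1) c d a b.
rewrite /zscale scaleN1r scaleNr scale1r addrC => ->.
by congr OE_of; ring.
Qed.

Lemma OE_of1 : OE_of p 1 0 = 1.
Proof. by rewrite /OE_of zscale0 addr0 /zscale !scale1r. Qed.

Lemma OE_of1B a b : 1 - OE_of p a b = OE_of p (1 - a) (- b).
Proof. by rewrite -OE_of1 OE_ofB sub0r. Qed.

(** The norm of [a + b h] from [E] to [Q_2]. *)
Definition OEnorm (a b : Z2) : Z2 := a * a - a * b + quarter * (b * b).

Lemma L0_form_norm a b x y :
  L0_form (OE_of p a b * x) (OE_of p a b * y) = OEnorm a b * L0_form x y.
Proof.
have [c [d ->]] := OE_ofP hp x; have [c' [d' ->]] := OE_ofP hp y.
by rewrite !OE_ofM !L0_formE /OEnorm; ring.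
Qed.

(** The adjoint of a multiplication is multiplication by the conjugate. *)
Lemma L0_form_adjoint (t : OE p) :
  exists t' : OE p, forall x y, L0_form (t * x) y = L0_form x (t' * y).
Proof.
have [a [b ->]] := OE_ofP hp t.
(* The conjugate of [h] is [- 1 - h]. *)
exists (OE_of p (a - b) (- b)) => x y.
have [c [d ->]] := OE_ofP hp x; have [c' [d' ->]] := OE_ofP hp y.
by rewrite !OE_ofM !L0_formE; ring.
Qed.

(** The norm of [a + b h] is [a^2 + a b + b^2] modulo 2, which is odd unless [a] and
[b] are both even; the inverse is then the conjugate divided by the norm. *)
Lemma OE_of_unit (a b : Z2) : (a 0%N != 0) || (b 0%N != 0) ->
  exists w, w * OE_of p a b = 1.
Proof.
move=> ab.
have Nu : OEnorm a b \is a GRing.unit.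
  apply: odd_Z2_unit.
  have -> : OEnorm a b 0%N =
    a 0%N * a 0%N - a 0%N * b 0%N + quarter 0%N * (b 0%N * b 0%N) by [].
  move: quarter_odd ab.
  move: (a 0%N) (b 0%N) (quarter 0%N) => x y z.
  by move: x y z; do 3![case=> [[|[|//]] ?]].
exists (OE_of p ((a - b) / OEnorm a b) (- b / OEnorm a b)).
rewrite OE_ofM -OE_of1; congr OE_of; last by ring.
by rewrite -(divrr Nu) {3}/OEnorm; ring.
Qed.

Lemma OE_double (y : OE p) : 2%:R * y = 0 -> y = 0.
Proof.
have [a [b ->]] := OE_ofP hp y.
have -> : 2%:R = OE_of p 2%:R 0.
  rewrite -[2%:R]/(1 + 1) -OE_of1; have := OE_of_lin p 1 1 0 1 0.
  by rewrite /zscale !scale1r mulr1 mul1r addr0.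
have -> : 0 = OE_of p 0 0 by rewrite /OE_of !zscale0 addr0.
rewrite OE_ofM => /OE_of_inj []; rewrite !mul0r !addr0 !mulr0 !subr0.
move=> /eqP; rewrite mulf_eq0 (negPf two_neq0) => /eqP -> /eqP.
by rewrite mulf_eq0 (negPf two_neq0) => /eqP ->.
Qed.

Lemma OE_scaleE (r : Rring p) (y : OE p) : r *: y = (r *: (1 : OE p)) * y.
Proof.
apply: val_inj; transitivity (R_to_E r * OEval y) => //.
by transitivity (R_to_E r * 1 * OEval y) => //; rewrite mulr1.
Qed.

(** [R]-linearity suffices for [O_E]-linearity, because [2 h] comes from [R] and
[O_E] has no 2-torsion. *)
Lemma OE_endo (f : {linear OE p -> OE p}) x : f x = f 1 * x.
Proof.
have omE : ('qX - 1 : Rring p) *: (1 : OE p) = 2%:R * OE_half_omega p.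
  apply: val_inj; transitivity (R_to_E ('qX - 1 : Rring p)); first exact: mulr1.
  transitivity (2%:R * half_omega p) => //.
  have [h0 h1] := half_omega_coef p; have t0 := twoF_neq0.
  rewrite mulr_natl mulr2n; have [r0 r1] := R_to_E_coef ('qX - 1 : Rring p).
  have [x0 x1] := quadXE Z2 p; have [y0 y1] := quad_coef1 Z2 p.
  apply: quad_ext.
    rewrite r0 !quad_coefD h0 quad_coefN x0 y0 add0r rmorphN rmorph1.
    by field.
  rewrite r1 !quad_coefD h1 quad_coefN x1 y1 subr0 rmorph1.
  by field.
have fh : f (OE_half_omega p) = f 1 * OE_half_omega p.
  apply/subr0_eq/OE_double.
  have f2 : f (2%:R * OE_half_omega p) = 2%:R * f (OE_half_omega p).
    by rewrite !mulr_natl raddfMn.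
  rewrite mulrBr -f2 -omE linearZ /= OE_scaleE omE.
  by rewrite [f 1 * _]mulrC mulrA subrr.
have [a [b ->]] := OE_ofP hp x.
rewrite /OE_of /zscale linearD !linearZ /= fh (OE_scaleE a%:A (f 1)).
rewrite (OE_scaleE b%:A (OE_half_omega p)) (OE_scaleE b%:A (f 1 * _)).
by ring.
Qed.

End MaximalOrder.

(** * Cancelling one copy of the rank-one module *)

Section Cancellation.
Local Open Scope ring_scope.
Variables (p : nat) (hp : p = 3 %[mod 8]).
Implicit Types M N : skewHermitianModule p.

Lemma OE_mul_linear (w : OE p) : linear (fun x : OE p => w * x).
Proof.
move=> r x y; rewrite mulrDr; congr (_ + _).
by rewrite OE_scaleE mulrCA -OE_scaleE.
Qed.

(** If [d] is multiplication by [t], then [d'] is the adjoint of [d], hence the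
adjoint of an inverse [w] of [1 - t] is an inverse of [1 - d']. *)
Lemma cancel_L0_unit M N
    (f : {linear osum M (L0 hp) -> osum N (L0 hp)}) :
  bijective f -> (forall x y, shm_form (f x) (f y) = shm_form x y) ->
  (exists w : OE p, w * (1 - ((f (0, 1)).2 : OE p)) = 1) ->
  isometric M N.
Proof.
move=> [g fK gK] fE [w wt].
pose t : OE p := (f (0, 1)).2.
have corner_lin : linear (fun x : OE p => (f (0, x)).2 : OE p).
  move=> r x y.
  have -> : (0, r *: x + y) = r *: (0, x) + (0, y) :> osum M (L0 hp).
    by congr pair; rewrite /= scaler0 addr0.
  by rewrite linearP.
pose corner : {linear OE p -> OE p} :=
  HB.pack (fun x : OE p => (f (0, x)).2 : OE p)
    (GRing.isLinear.Build _ _ _ _ _ corner_lin).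
have cornerE (x : OE p) : (f (0, x)).2 = t * x by exact: (OE_endo hp corner).
pose wL : {linear L0 hp -> L0 hp} :=
  HB.pack (fun x : OE p => w * x : OE p)
    (GRing.isLinear.Build _ _ _ _ _ (OE_mul_linear w)).
apply: (feedback_isometric fK gK fE).
  exists wL => y; rewrite !cornerE /=; split.
    rewrite -[X in X - _]mul1r -mulrBl mulrA [_ * w]mulrC wt; exact: mul1r.
  rewrite -[X in X - _]mul1r -mulrBl mulrA wt; exact: mul1r.
have adj (x y : OE p) : L0_form (t * x) y = L0_form x (g (0, y)).2.
  have := fE (0, x) (g (0, y)); rewrite gK /= /osum_form /= !shm_form0l !add0r.
  by rewrite shm_form0r add0r cornerE.
have [w' w'E] := L0_form_adjoint hp w.
move=> y; exists (w' * y); apply: (@shm_form_sep _ (L0 hp)) => z.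
apply: (addIr (shm_form z (g (0, w' * y)).2)); rewrite -shm_formD subrK /=.
have zE : z = w * (z - t * z :> OE p).
  by rewrite -[X in X - _]mul1r -mulrBl mulrA wt; exact/esym/mul1r.
rewrite -adj {2}zE w'E.
have -> : L0_form z (w' * y) = L0_form ((z - t * z) + t * z) (w' * y) by rewrite subrK.
exact: (@shm_formDl _ (L0 hp)).
Qed.

(** If [1 - t] is a unit, take [c = 1].  Otherwise [t = 1 mod 2], and any unit [c]
of norm 1 with [c <> 1 mod 2] works.  The choice [c = - 1 - h / quarter] is the
quotient of [h] by its conjugate. *)
Lemma L0_twist_unit (t : OE p) : exists c : OE p,
  [/\ forall x y, L0_form (c * x) (c * y) = L0_form x y,
      exists d, d * c = 1 & exists w, w * (1 - c * t) = 1].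
Proof.
have [a [b ->]] := OE_ofP hp t.
have [/OE_of_unit u|] := boolP (((1 - a) 0%N != 0) || ((- b) 0%N != 0)).
  exists 1; split; first by move=> x y; rewrite !mul1r.
    by exists 1; rewrite mul1r.
  have [w wE] := u _ hp; exists w.
  by rewrite mul1r OE_of1B.
rewrite negb_or !negbK => ab.
pose q := quarter p; pose q' := q^-1.
have qu : q \is a GRing.unit by apply/odd_Z2_unit/quarter_odd.
have q'u : q' 0%N != 0.
  apply: contraTneq isT => q0; have := congr1 (fun z : Z2 => z 0%N) (mulrV qu).
  by rewrite -/q' /= q0 mulr0 => /eqP.
have n1 : OEnorm p (-1) (- q') = 1.
  rewrite /OEnorm -/q.
  have -> : q * (- q' * - q') = q'.
    by rewrite mulrNN mulrA mulrV ?mul1r.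
  by ring.
exists (OE_of p (-1) (- q')); split.
- by move=> x y; rewrite (L0_form_norm hp) n1 mul1r.
- exact: (OE_of_unit hp).
rewrite OE_ofM // OE_of1B; apply: OE_of_unit => //.
have -> : - (-1 * b + - q' * a - - q' * b) = b + q' * a - q' * b by ring.
apply/orP; right; move: ab.
have -> : (b + q' * a - q' * b) 0%N = b 0%N + q' 0%N * a 0%N - q' 0%N * b 0%N by [].
have -> : (1 - a) 0%N = 1 - a 0%N by [].
have -> : (- b) 0%N = - b 0%N by [].
move: q'u (a 0%N) (b 0%N); move: (q' 0%N) => x + y z.
(* A check over the field with two elements. *)
by move: x y z; do 3![case=> [[|[|//]] ?]].
Qed.

Lemma cancel_L0 M N :
  isometric (osum M (L0 hp)) (osum N (L0 hp)) -> isometric M N.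
Proof.
move=> [f [bf fE]].
have [c [cE [d dc] [w wE]]] := L0_twist_unit ((f (0, 1)).2 : OE p).
pose T (u : osum N (L0 hp)) : osum N (L0 hp) := (u.1, c * (u.2 : OE p)).
have T_lin : linear T.
  by move=> r x y; congr pair; exact: OE_mul_linear.
pose TL : {linear osum N (L0 hp) -> osum N (L0 hp)} :=
  HB.pack T (GRing.isLinear.Build _ _ _ _ _ T_lin).
have bT : bijective T.
  exists (fun u => (u.1, d * (u.2 : OE p))).
    by move=> [x l]; congr pair; rewrite /= mulrA dc mul1r.
  by move=> [x l]; congr pair; rewrite /= mulrA [c * d]mulrC dc mul1r.
apply: (@cancel_L0_unit M N (TL \o f : {linear _ -> _})).
- exact: (bij_comp bT bf).
- by move=> x y; rewrite -fE /= /osum_form /= cE.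
- by exists w.
Qed.

End Cancellation.

Theorem proposition5p7 (p : nat) (p_prime : prime p) (hp : p = 3 %[mod 8])
    (M1 M2 : skewHermitianModule p) (s : nat) :
  self_dual M1 -> self_dual M2 ->
  isometric (osum M1 (opow (L0 hp) s)) (osum M2 (opow (L0 hp) s)) ->
  isometric M1 M2.
Proof.
move=> _ _; elim: s => [|s IH] iso.
  apply: isometric_trans (isometric_osum0 M2 (L0 hp)).
  apply: isometric_trans iso.
  exact/isometric_sym/isometric_osum0.
apply/IH/(@cancel_L0 _ hp).
apply: isometric_trans (isometric_osumS M2 (L0 hp) s).
apply: isometric_trans iso.
exact/isometric_sym/isometric_osumS.
Qed.
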